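(* For any odd prime power $q$ we have $M(q)\le 32(\log q)^4q$.
   Context: A set of polynomials $f_1,\ldots,f_r$ of positive degree over a finite field $\mathbb{F}_q$ is called dynamically-irreducible if all polynomials formed by composition of $f_1,\ldots,f_r$, i.e. all $f_{i_1}\circ f_{i_2}\circ\cdots\circ f_{i_n}$ with $n\ge 1$ and $i_1,\ldots,i_n\in\{1,\ldots,r\}$ (repetitions allowed), are irreducible over $\mathbb{F}_q$. For a prime power $q$, $M(q)$ denotes the maximal size of a set of (distinct) monic quadratic polynomials over $\mathbb{F}_q$ which is dynamically-irreducible. Here $\log$ is the natural logarithm. *)

(* Defs.v *)
(* MathComp world, with MathComp-Analysis for the natural logarithm [ln]. *)
From mathcomp Require Import all_boot all_order all_algebra all_field.
From mathcomp Require Import boolp reals exp.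

Set Implicit Arguments.
Unset Strict Implicit.
Unset Printing Implicit Defensive.

Import Order.TTheory GRing.Theory Num.Theory.
Local Open Scope ring_scope.

(* [compose_all [:: f_1; ..; f_n]] is f_1 \o f_2 \o .. \o f_n; the innermost
   'X is neutral for \Po. *)
Definition compose_all (F : fieldType) (s : seq {poly F}) : {poly F} :=
  foldr (fun f g => f \Po g) 'X s.

(* Positivity of the degrees is the case of one-letter words, since
   [irreducible_poly] excludes constants. *)
Definition dynamically_irreducible (F : fieldType) (S : {pred {poly F}}) :
    Prop :=
  forall s : seq {poly F}, s != [::] -> {subset s <= S} ->
    irreducible_poly (compose_all s).

Definition monic_quadratic (F : fieldType) (f : {poly F}) : bool :=
  (f \is monic) && (size f == 3).

(* {poly_3 F} is the finite type of polynomials of degree at most 2, so that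
   [A] below ranges over all sets of (distinct) quadratic polynomials. *)
Definition admissible (F : finFieldType) (A : {set {poly_3 F}}) : Prop :=
  (forall f, f \in A -> monic_quadratic (val f)) /\
  dynamically_irreducible [in [seq val f | f in A]].

(* M(q), where #|F| = q. *)
Definition M (F : finFieldType) : nat :=
  \max_(A : {set {poly_3 F}} | `[< admissible A >]) #|A|.

Lemma leq_M (F : finFieldType) (S : seq {poly F}) :
  uniq S -> {in S, forall f, monic_quadratic f} ->
  dynamically_irreducible [in S] -> (size S <= M F)%N.
Proof.
move=> uS mS dS.
pose A : {set {poly_3 F}} := [set f | val f \in S].
have memA g : g \in S -> exists2 f, f \in A & g = val f.
  move=> gS; have /andP[_ /eqP sg] := mS _ gS.
  have g3 : g \is a poly_of_size 3 by rewrite qualifE /= sg.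
  by exists (NPoly g3); rewrite ?inE.
have admA : admissible A.
  split=> [f|s s0 sS]; first by rewrite inE => /mS.
  by apply: dS => // g /sS /imageP[f]; rewrite !inE => fS ->.
apply: (@leq_trans #|A|); last first.
  by apply: (leq_bigmax_cond (F := fun A : {set {poly_3 F}} => #|A|));
    apply/asboolP.
have <- : size [seq val f | f in A] = #|A| by rewrite size_map -cardE.
apply: uniq_leq_size => // g /memA[f fA ->].
by apply: map_f; rewrite mem_enum.
Qed.

Lemma M_attained (F : finFieldType) :
  exists S : seq {poly F}, [/\ uniq S, {in S, forall f, monic_quadratic f},
    dynamically_irreducible [in S] & size S = M F].
Proof.
have adm0 : admissible (set0 : {set {poly_3 F}}).
  split=> [f|[//|g s] _ sS]; first by rewrite inE.
  by have /imageP[f] := sS g (mem_head _ _); rewrite inE.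
have [|A /asboolP[mA dA] MA] := @eq_bigmax_cond _
    (fun A : {set {poly_3 F}} => `[< admissible A >]) (fun A => #|A|).
  by apply/card_gt0P; exists set0; apply/asboolP.
exists [seq val f | f in A]; split=> //.
- by rewrite map_inj_uniq ?enum_uniq //; exact: val_inj.
- by move=> g /imageP[f fA ->]; exact: mA.
- by rewrite size_map -cardE /M MA.
Qed.

(* Main.v *)
Require Import Defs.
From HB Require Import structures.
From mathcomp Require Import all_boot all_order all_algebra all_field.
From mathcomp Require Import boolp reals exp.
From mathcomp Require Import zify ring lra.

(** The proof gives the stronger bound M(q) <= 2q; the logarithms only enter
    through 2 <= 32 (log q)^4, valid for q >= 3.

    Let S be a dynamically irreducible set of monic quadratics
    f = (X - a_f)^2 + b_f, and let T be the set of all values w(b_f) with f in S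
    and w a nonempty composition of elements of S.  Two properties of T matter.
    - T consists of nonsquares ([symmetric_irreducible_nonsquare]): the
      polynomial h = w(f(X)) is irreducible, its degree is divisible by 4, it is
      symmetric about a_f, and h(a_f) = w(b_f).  If z is a root of h and n is
      half its degree, then y = z - a_f satisfies y^(q^n) = -y, so that the
      product u of the y^(q^i), i < n, satisfies u^2 = h(a_f) and u^q = -u;
      hence h(a_f) has no square root in the base field.  In particular
      2 #T <= q.
    - T is mapped into itself by every f in S.

    When g runs over all q^2 monic quadratics, the values of g at two distinct
    points are independent and uniform.  Hence the number Z(g) of x in T with
    g(x) in T has mean t^2 / q and total squared deviation t^2 (q - t), where
    t = #T ([hits_variance]).  As Z(f) = t for f in S, Chebyshev's inequality
    gives #S (q - t) <= q^2 ([closed_family_bound]), and #S <= 2q follows from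
    2t <= q. *)

Set Implicit Arguments.
Unset Strict Implicit.
Unset Printing Implicit Defensive.

Import Order.TTheory GRing.Theory Num.Theory.
Local Open Scope ring_scope.

(** * Irreducible polynomials symmetric about a point *)

Lemma odd_card_two_neq0 (F : finFieldType) : odd #|F| -> (2 : F) != 0.
Proof.
move=> oddF; apply/eqP => t0.
have p2 : 2%N \in [pchar F] by rewrite inE /= t0 eqxx.
move: oddF (finNzRing_gt1 F); rewrite (card_pprimeChar p2) oddX orbF.
by move/eqP ->.
Qed.

Section Frobenius.
Variables (F : finFieldType) (L : fieldExtType F).
Local Notation q := #|F|.

(** Raising to the power q ^ i is additive on [L], by [exprDn_pchar]. *)
Lemma pnat_card_pchar i : [pchar L].-nat (q ^ i)%N.
Proof.
have [p p_pr pF] := finPcharP F.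
have pL : p \in [pchar L] by rewrite pchar_lalg.
rewrite pnatX (eq_pnat _ (pcharf_eq pL)) (card_pprimeChar pF).
by rewrite pnatX pnat_id ?orbT.
Qed.

Lemma conj_algA (a : F) i : (a%:A : L) ^+ (q ^ i)%N = a%:A.
Proof.
rewrite -in_algE -rmorphXn /=; congr (_ %:A).
by elim: i => [|i IH]; rewrite ?expr1 // expnSr exprM IH expf_card.
Qed.

Lemma conj_fixed_base (x : L) : x ^+ q = x -> exists a : F, x = a%:A.
Proof.
move=> xq; apply/vlineP.
by rewrite (Fermat's_little_theorem (aspace1 L)) dimv1 expn1 xq.
Qed.

Lemma conj_dim (x : L) : x ^+ (q ^ \dim {:L})%N = x.
Proof.
by apply/eqP; rewrite -(Fermat's_little_theorem (aspacef L)) memvf.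
Qed.

(** The Frobenius x |-> x ^+ q permutes the factors of the product cyclically,
    so it fixes all its coefficients. *)
Lemma conj_prod_descends (z : L) e : z ^+ (q ^ e)%N = z ->
  exists g : {poly F},
    map_poly (in_alg L) g = \prod_(i < e) ('X - (z ^+ (q ^ i)%N)%:P).
Proof.
move=> ze; set G := \prod_(i < e) _.
have [fr frE] : exists fr : {rmorphism L -> L}, forall x, fr x = x ^+ q.
  have frA : zmod_morphism (fun x : L => x ^+ q).
    have qn : [pchar L].-nat q by have := pnat_card_pchar 1; rewrite expn1.
    by move=> x y; rewrite /= exprDn_pchar // exprNn_pchar.
  have frM : monoid_morphism (fun x : L => x ^+ q).
    by split=> [|x y]; rewrite ?expr1n ?exprMn.
  pose fa := GRing.isZmodMorphism.Build _ _ _ frA.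
  pose fm := GRing.isMonoidMorphism.Build _ _ _ frM.
  by exists (HB.pack_for {rmorphism L -> L} (fun x : L => x ^+ q) fa fm).
have frG : map_poly fr G = G.
  rewrite rmorph_prod.
  have frX i : map_poly fr ('X - (z ^+ (q ^ i)%N)%:P)
      = 'X - (z ^+ (q ^ i.+1)%N)%:P.
    by rewrite rmorphB /= map_polyX map_polyC /= frE -exprM -expnSr.
  rewrite (eq_bigr _ (fun (i : 'I_e) _ => frX i)).
  case: (e) @G ze => [|k] G ze; first by rewrite /G !big_ord0.
  rewrite /G big_ord_recr ze big_ord_recl mulrC expn0 expr1; congr (_ * _).
have Gc i : exists c : F, G`_i == c%:A.
  have [|c ->] := @conj_fixed_base G`_i; last by exists c.
  by rewrite -{2}frG coef_map /= frE.
exists (\poly_(i < size G) xchoose (Gc i)); apply/polyP => i.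
rewrite coef_map coef_poly; case: ltnP => [_|ge].
  by rewrite /= -(eqP (xchooseP (Gc i))).
by rewrite nth_default ?rmorph0 //=; rewrite ?scale0r.
Qed.

Lemma irreducible_dvd_conj_prod (h : {poly F}) (z : L) e :
    irreducible_poly h -> root (map_poly (in_alg L) h) z ->
    (0 < e)%N -> z ^+ (q ^ e)%N = z ->
  map_poly (in_alg L) h %| \prod_(i < e) ('X - (z ^+ (q ^ i)%N)%:P).
Proof.
move=> [_ irr_h] hz e0 ze; have [g gE] := conj_prod_descends ze.
rewrite -gE dvdp_map.
have gz : root (map_poly (in_alg L) g) z.
  by rewrite gE -(prednK e0) big_ord_recl rootM root_XsubC expr1 eqxx.
have [cop|ncop] := boolP (coprimep h g).
  have := cop; rewrite -(coprimep_map (in_alg L)) => /coprimep_root/(_ hz).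
  by rewrite -rootE gz.
rewrite -(eqp_dvdl _ (irr_h _ ncop (dvdp_gcdl _ _))); exact: dvdp_gcdr.
Qed.

(** The Frobenius orbit of a root of [h] has at least deg h elements. *)
Lemma irreducible_conj_period (h : {poly F}) (z : L) e :
    irreducible_poly h -> root (map_poly (in_alg L) h) z ->
    (0 < e)%N -> z ^+ (q ^ e)%N = z ->
  ((size h).-1 <= e)%N.
Proof.
move=> irr_h hz e0 ze.
have /dvdp_leq := irreducible_dvd_conj_prod irr_h hz e0 ze.
rewrite monic_neq0 ?monic_prod_XsubC // => /(_ isT).
rewrite size_prod_XsubC size_map_poly /index_enum -enumT size_enum_ord.
by case: (size h).
Qed.

End Frobenius.

(** The hypothesis on the composition says h(2a - X) = h(X).  The symmetry makes
    a - y a root of [h] together with z = a + y, hence a conjugate of z. *)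
Lemma symmetric_irreducible_nonsquare (F : finFieldType) (h : {poly F})
    (a s : F) :
    odd #|F| -> h \is monic -> irreducible_poly h -> (4 %| (size h).-1)%N ->
    h \Po ((a + a)%:P - 'X) = h ->
  h.[a] != s ^+ 2.
Proof.
move=> oddF hm irr_h h4 sym; apply/eqP => has.
have [L dimL [z hz _]] := irredp_FAdjoin irr_h.
set d := (size h).-1 in h4 dimL.
have [n dE nev] : exists2 n, d = (n + n)%N & ~~ odd n.
  by case/dvdnP: h4 => k ->; exists (k * 2)%N; rewrite ?oddM ?andbF // -mulnDr.
have d1 : (1 < d)%N.
  have [h1 _] := irr_h.
  have : (0 < d)%N by rewrite /d; case: (size h) h1 => [|[]].
  by rewrite dE; case: (n) => [|k]; rewrite ?addnS.
(* [c x i] is the i-th conjugate of [x]. *)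
pose c (x : L) i := x ^+ (#|F| ^ i)%N.
have cD x y i : c (x + y) i = c x i + c y i.
  by rewrite /c exprDn_pchar ?pnat_card_pchar.
have cN x i : c (- x) i = - c x i by rewrite /c exprNn_pchar ?pnat_card_pchar.
have cS x i j : c x (i + j)%N = c (c x i) j by rewrite /c expnD exprM.
have cA b i : c b%:A i = b%:A by rewrite /c conj_algA.
have two0 : (2 : L) != 0.
  by rewrite -(rmorph_nat (in_alg L)) fmorph_eq0 odd_card_two_neq0.
have neq_opp (x : L) : x = - x -> x = 0.
  move/eqP; rewrite -subr_eq0 opprK -mulr2n -mulr_natl mulf_eq0 (negPf two0).
  by move/eqP.
set hL := map_poly (in_alg L) h in hz.
have cd x : c x d = x by rewrite /c -dimL conj_dim.
have hE : hL = \prod_(i < d) ('X - (c z i)%:P).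
  have := irreducible_dvd_conj_prod irr_h hz (ltnW d1) (cd z).
  move/dvdp_size_eqp; rewrite eqp_monic ?monic_prod_XsubC ?map_monic //.
  rewrite size_prod_XsubC size_map_poly /index_enum -enumT size_enum_ord.
  by rewrite prednK ?eqxx; [move/esym/eqP|case: irr_h => /ltnW].
have period e : (0 < e)%N -> c z e = z -> (d <= e)%N.
  by move=> e0 ze; apply: (irreducible_conj_period irr_h hz).
pose y := z - a%:A.
have zE : z = y + a%:A by rewrite subrK.
have y0 : y != 0.
  apply/eqP => y0; have := period 1%N isT; rewrite zE y0 add0r cA leqNgt d1.
  by move/(_ erefl).
have [i lt_id yi] : exists2 i, (i < d)%N & c y i = - y.
  have : root hL (a%:A - y).
    rewrite /hL -sym map_comp_poly /root horner_comp rmorphB /=.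
    rewrite map_polyX map_polyC /=.
    rewrite !hornerE /= scalerDl /y -/hL.
    by move: (a%:A : L) => A; have -> : A + A - (A - (z - A)) = z by ring.
  rewrite hE /root horner_prod prodf_seq_eq0 => /hasP[i _ /=].
  rewrite !hornerE subr_eq0 zE cD cA addrC => /eqP/addIr yi.
  by exists i.
have zper e : c y e = y -> c z e = z by move=> ye; rewrite zE cD cA ye.
have y2i : c y (i + i)%N = y by rewrite cS yi cN yi opprK.
(* y is fixed by the 2i-th and the d-th power of the Frobenius, and by none
   between 0 and d, so that 2i is 0 or d. *)
have iE : i = n.
  case: (ltngtP i n) => // lin.
    case: (posnP i) yi => [->|i0 _].
      by rewrite /c expn0 expr1 => /neq_opp/eqP; rewrite (negPf y0).
    have := period (i + i)%N _ (zper _ y2i); lia.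
  have y2d : c y (i + i - d)%N = y.
    by rewrite -{2}y2i -{1}(cd y) -cS subnKC // dE; lia.
  have := period (i + i - d)%N _ (zper _ y2d); lia.
rewrite {i}iE in yi lt_id y2i.
pose u := \prod_(i < n) c y i.
have u0 : u != 0 by apply/prodf_neq0 => i _; rewrite expf_neq0.
have uq : u ^+ #|F| = - u.
  apply: (mulfI y0); rewrite mulrN -mulNr -yi [RHS]mulrC.
  have -> : c y n = c y (val (@ord_max n)) by [].
  rewrite -(@big_ord_recr _ _ _ n (fun i => c y i)) big_ord_recl.
  rewrite [c y _]expr1 /u -prodrXl; congr (_ * _).
  by apply: eq_bigr => i _; rewrite /c -exprM -expnSr.
have fac i : ('X - (c z i)%:P).[a%:A] = - c y i.
  by rewrite hornerXsubC zE cD cA opprD addrCA subrr addr0.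
(* Evaluate the factorization of [h] at a: the factors of index i and n + i are
   - c y i and c y i, and the n signs cancel since n is even. *)
have usq : u ^+ 2 = (s%:A) ^+ 2.
  have -> : (s%:A : L) ^+ 2 = hL.[a%:A].
    by rewrite /hL -in_algE horner_map has rmorphXn.
  rewrite hE horner_prod dE big_split_ord /=.
  have -> : \prod_(i < n) ('X - (c z i)%:P).[a%:A] = u.
    rewrite (eq_bigr _ (fun (i : 'I_n) _ => fac i)).
    by rewrite prodrN card_ord -signr_odd (negPf nev) mul1r.
  have -> : \prod_(i < n) ('X - (c z (n + i))%:P).[a%:A] = u.
    apply: eq_bigr => i _.
    by rewrite fac cS yi cN opprK.
  by rewrite expr2.
(* u = s or u = - s, so that u lies in the base field, against u ^+ q = - u. *)
have /eqP : u ^+ #|F| = u.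
  move/eqP: usq; rewrite eqf_sqr => /orP[]/eqP->.
    by rewrite -[#|F|]expn1 conj_algA.
  by rewrite -scaleNr -[#|F|]expn1 conj_algA.
by rewrite uq eq_sym => /eqP/neq_opp/eqP; rewrite (negPf u0).
Qed.

(** * Second moment over the monic quadratics *)

Lemma polyE_quadratic (F : fieldType) (f : {poly F}) :
  monic_quadratic f -> f = 'X^2 + f`_1 *: 'X + (f`_0)%:P.
Proof.
move=> /andP[/monicP lf /eqP sf]; rewrite /lead_coef sf /= in lf.
apply/polyP => i; rewrite !coefE; case: i => [|[|[|i]]] /=;
  rewrite ?mulr1 ?mulr0 ?add0r ?addr0 //.
by rewrite nth_default // sf.
Qed.

Section SecondMoment.
Variables (F : finFieldType) (T : {set F}).

(** The value at [x] of the monic quadratic X^2 + p.1 X + p.2; the pair [p] thus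
    stands for a monic quadratic polynomial. *)
Definition quad_eval (p : F * F) (x : F) : F := x ^+ 2 + p.1 * x + p.2.

(** The number of points of [T] that the quadratic [p] sends into [T]. *)
Definition hits (p : F * F) : nat := (\sum_(x in T) (quad_eval p x \in T))%N.

Lemma card_quad_eval x :
  (\sum_(p : F * F) (quad_eval p x \in T) = #|F| * #|T|)%N.
Proof.
pose phi (p : F * F) := (p.1, quad_eval p x).
have phi_inj : injective phi.
  by case=> b c [b' c']; rewrite /phi /quad_eval /= => -[-> /addrI ->].
have := card_preimset (setX [set: F] T) phi_inj.
rewrite cardsX cardsT => <-; rewrite -sum1_card [RHS]big_mkcond.
by apply: eq_bigr => p _; rewrite !inE /=; case: (_ \in T).
Qed.

(** A monic quadratic is determined by its values at two distinct points. *)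
Lemma card_quad_eval2 x y : x != y ->
  (\sum_(p : F * F) (quad_eval p x \in T) * (quad_eval p y \in T)
     = #|T| * #|T|)%N.
Proof.
move=> xy; pose phi (p : F * F) := (quad_eval p x, quad_eval p y).
have phi_inj : injective phi.
  case=> b c [b' c']; rewrite /phi /quad_eval /= => -[ex ey].
  have bb : b = b'.
    apply/eqP; rewrite -subr_eq0; have := subr_eq0 x y.
    rewrite (negPf xy) => nz.
    have : (b - b') * (x - y) = 0.
      transitivity ((x ^+ 2 + b * x + c) - (x ^+ 2 + b' * x + c')
        - ((y ^+ 2 + b * y + c) - (y ^+ 2 + b' * y + c'))); first by ring.
      by rewrite ex ey !subrr.
    by move/eqP; rewrite mulf_eq0 nz orbF.
  by move: ex; rewrite bb => /addrI ->.
have := card_preimset (setX T T) phi_inj.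
rewrite cardsX => <-; rewrite -sum1_card [RHS]big_mkcond.
by apply: eq_bigr => p _; rewrite inE in_setX /=; do 2!case: (_ \in T).
Qed.

Lemma sum_hits : (\sum_p hits p = #|F| * #|T| ^ 2)%N.
Proof.
rewrite /hits exchange_big /= (eq_bigr _ (fun x _ => card_quad_eval x)).
by rewrite sum_nat_const mulnCA mulnn.
Qed.

Lemma sum_hits_sqr :
  (\sum_p hits p ^ 2 = #|F| * #|T| ^ 2 + (#|T| * #|T|.-1) * #|T| ^ 2)%N.
Proof.
transitivity (\sum_(x in T) \sum_(y in T) \sum_(p : F * F)
   (quad_eval p x \in T) * (quad_eval p y \in T))%N.
  under [RHS]eq_bigr => x _ do rewrite exchange_big /=.
  rewrite exchange_big /=; apply: eq_bigr => p _.
  by rewrite -mulnn {1}/hits big_distrl; apply: eq_bigr => x _;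
    rewrite big_distrr.
transitivity (\sum_(x in T) (#|F| * #|T| + #|T|.-1 * #|T| ^ 2))%N; last first.
  by rewrite sum_nat_const mulnDr mulnCA mulnn mulnA.
apply: eq_bigr => x xT; rewrite (bigD1 x) //=; congr (_ + _)%N.
  by rewrite -(card_quad_eval x); apply: eq_bigr => p _; case: (_ \in T).
rewrite (eq_bigr (fun _ => #|T| * #|T|)%N) => [|y /andP[_ yx]]; last first.
  by rewrite card_quad_eval2 // eq_sym.
rewrite sum_nat_const mulnn; congr (_ * _)%N.
by rewrite (cardsD1 x T) xT /=; apply: eq_card => y; rewrite !inE andbC.
Qed.

(** The deviation of [hits] from its mean t ^ 2 / q, scaled by q to stay in the
    integers. *)
Lemma hits_variance :
  \sum_p (#|F|%:Z * (hits p)%:Z - (#|T| ^ 2)%:Z) ^+ 2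
    = (#|F| ^ 2 * #|T| ^ 2)%:Z * (#|F|%:Z - #|T|%:Z).
Proof.
have s1 : \sum_p (hits p)%:Z = (#|F| * #|T| ^ 2)%:Z.
  by rewrite -sum_hits (big_morph Posz PoszD (erefl _)).
have s2 : \sum_p (hits p)%:Z ^+ 2
    = (#|F| * #|T| ^ 2 + (#|T| * #|T|.-1) * #|T| ^ 2)%:Z.
  by rewrite -sum_hits_sqr (big_morph Posz PoszD (erefl _)).
transitivity (#|F|%:Z ^+ 2 * (\sum_p (hits p)%:Z ^+ 2)
   - 2 * #|F|%:Z * (#|T| ^ 2)%:Z * (\sum_p (hits p)%:Z)
   + #|{: F * F}|%:Z * (#|T| ^ 2)%:Z ^+ 2).
  rewrite !mulr_sumr -sumrB.
  have -> (z : int) : #|{: F * F}|%:Z * z = \sum_(p : F * F) z.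
    by rewrite sumr_const -mulr_natl natz.
  by rewrite -big_split /=; apply: eq_bigr => p _; ring.
(* The case split removes the predecessor of #|T| in [s2]. *)
rewrite s1 s2 card_prod; case: #|T| => [|t] /=;
  by rewrite ?PoszD ?PoszM ?expnS ?expn0 ?PoszM; ring.
Qed.

(** Chebyshev's inequality for [hits]: every member of [S] sends all of [T] into
    [T], which is far from the mean. *)
Lemma closed_family_bound (S : seq {poly F}) :
    uniq S -> {in S, forall f, monic_quadratic f} ->
    (0 < #|T|)%N -> (#|T| < #|F|)%N ->
    {in S & T, forall f x, f.[x] \in T} ->
  (size S * (#|F| - #|T|) <= #|F| ^ 2)%N.
Proof.
move=> uS mS t0 tq clS.
pose cf (f : {poly F}) := (f`_1, f`_0).
have cf_inj : {in S &, injective cf}.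
  move=> f g /mS/polyE_quadratic fE /mS/polyE_quadratic gE [e1 e0].
  by rewrite fE gE e1 e0.
have evE f x : f \in S -> f.[x] = quad_eval (cf f) x.
  by move/mS/polyE_quadratic => {1}->; rewrite !hornerE.
have hitsE f : f \in S -> hits (cf f) = #|T|.
  move=> fS; rewrite -sum1_card; apply: eq_bigr => x xT.
  by rewrite -evE // clS.
have uA : uniq (map cf S) by rewrite map_inj_in_uniq.
have : (size S)%:Z * (#|F|%:Z * #|T|%:Z - (#|T| ^ 2)%:Z) ^+ 2
    <= (#|F| ^ 2 * #|T| ^ 2)%:Z * (#|F|%:Z - #|T|%:Z).
  rewrite -hits_variance.
  apply: (@le_trans _ _ (\sum_(p <- map cf S)
      (#|F|%:Z * (hits p)%:Z - (#|T| ^ 2)%:Z) ^+ 2)).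
    rewrite big_map big_seq.
    rewrite (eq_bigr (fun=> (#|F|%:Z * #|T|%:Z - (#|T| ^ 2)%:Z) ^+ 2)).
      by rewrite -big_seq big_const_seq count_predT iter_addr_0 -mulr_natl natz.
    by move=> f fS; rewrite hitsE.
  rewrite (big_uniq _ uA) [leRHS](bigID (mem (map cf S))) /= lerDl.
  by apply: sumr_ge0 => p _; exact: sqr_ge0.
have -> : #|F|%:Z * #|T|%:Z - (#|T| ^ 2)%:Z = #|T|%:Z * (#|F| - #|T|)%:Z.
  by rewrite -subzn ?(ltnW tq) // expnS expn1 PoszM; ring.
rewrite subzn ?(ltnW tq) // expr2 -!PoszM lez_nat.
have d0 : (0 < #|T| ^ 2 * (#|F| - #|T|))%N.
  by rewrite muln_gt0 expn_gt0 t0 subn_gt0.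
move=> H; rewrite -(leq_pmul2l d0); move: H; move: (_ - _)%N => d.
by move=> H; apply: etrans H; congr leq; ring.
Qed.

End SecondMoment.

(** * Compositions of monic quadratics *)

Section Words.
Variable F : fieldType.
Implicit Types (f : {poly F}) (s : seq {poly F}).

(** The centre of symmetry of the monic quadratic [f] when 2 is invertible, that
    is a when f = (X - a)^2 + b; then b = f.[axis f]. *)
Definition axis f : F := - f`_1 / 2.

Lemma quadratic_symmetric f : (2 : F) != 0 -> monic_quadratic f ->
  f \Po ((axis f + axis f)%:P - 'X) = f.
Proof.
move=> nz2 /polyE_quadratic fE.
have -> : axis f + axis f = - f`_1 by rewrite /axis; field.
move: (f`_1) (f`_0) fE => b c ->.
rewrite !comp_polyD comp_polyZ comp_polyX comp_polyC comp_Xn_poly.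
by rewrite -!mul_polyC polyCN; ring.
Qed.

Lemma compose_all_rcons s f :
  compose_all (rcons s f) = compose_all s \Po f.
Proof.
elim: s => [|g s IH] /=; first by rewrite comp_polyX comp_polyXr.
by rewrite /compose_all /= in IH *; rewrite IH comp_polyA.
Qed.

Lemma size_compose_all s : {in s, forall f, monic_quadratic f} ->
  (size (compose_all s)).-1 = (2 ^ size s)%N.
Proof.
elim: s => [|g s IH] qs; first by rewrite size_polyX.
rewrite size_comp_poly IH => [|f fs]; last by apply: qs; rewrite inE fs orbT.
by have /andP[_ /eqP ->] := qs g (mem_head _ _); rewrite expnS.
Qed.

Lemma monic_compose_all s : {in s, forall f, monic_quadratic f} ->
  compose_all s \is monic.
Proof.
elim: s => [|g s IH] qs; first exact: monicX.
have qs' : {in s, forall f, monic_quadratic f}.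
  by move=> f fs; apply: qs; rewrite inE fs orbT.
have /andP[/monicP lg _] := qs g (mem_head _ _).
have sz : (1 < size (compose_all s))%N.
  have : (0 < 2 ^ size s)%N by rewrite expn_gt0.
  by rewrite -(size_compose_all qs'); case: (size (compose_all s)) => [|[]].
by rewrite monicE lead_coef_comp // lg (monicP (IH qs')) expr1n mulr1.
Qed.

End Words.

(** * The bound *)

Lemma card_disjoint_squares (F : finFieldType) (T : {set F}) :
  {in T, forall x s, x != s ^+ 2} -> (2 * #|T| <= #|F|)%N.
Proof.
move=> nsT; pose Q := [set x ^+ 2 | x in F].
have TQ : (#|T| + #|Q| <= #|F|)%N.
  have -> : (#|T| + #|Q| = #|T :|: Q|)%N.
    rewrite cardsU disjoint_setI0 ?cards0 ?subn0 //.
    apply/pred0P => x /=; apply/negbTE/negP => /andP[xT /imsetP[s _ xs]].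
    by have := nsT _ xT s; rewrite xs eqxx.
  exact: max_card.
(* Squaring is at most two-to-one. *)
have : (#|F| <= #|Q| * 2)%N.
  rewrite -[leqLHS]sum1_card.
  rewrite (partition_big (fun x => x ^+ 2) (mem Q)) /=; last first.
    by move=> x _; apply: imset_f.
  rewrite -sum_nat_const; apply: leq_sum => y /imsetP[x0 _ ->].
  rewrite sum1_card; apply: (@leq_trans #|[set x0; - x0]|); last first.
    by rewrite cards2; case: (_ == _).
  by apply: subset_leq_card; apply/subsetP => x; rewrite !inE -eqf_sqr.
lia.
Qed.

(** The bound M(q) <= 2q, for the set of elements of [S]. *)
Lemma dynamically_irreducible_size (F : finFieldType) (S : seq {poly F}) :
    odd #|F| -> uniq S -> {in S, forall f, monic_quadratic f} ->
    dynamically_irreducible [in S] ->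
  (size S <= 2 * #|F|)%N.
Proof.
move=> oddF uS qS irrS.
case: (S =P [::]) => [-> //|/eqP S0].
have [f0 f0S] : exists f0, f0 \in S.
  by case: (S) S0 => // f s _; exists f; exact: mem_head.
(* [f.[axis f]] is the constant b of f = (X - a)^2 + b. *)
pose T := [set x | `[< exists s f, [/\ s != [::], {subset s <= S}, f \in S
                        & x = (compose_all s).[f.[axis f]]] >]].
have T0 : (0 < #|T|)%N.
  apply/card_gt0P; exists (compose_all [:: f0]).[f0.[axis f0]].
  rewrite inE; apply/asboolP; exists [:: f0], f0; split=> //.
  by move=> g; rewrite inE => /eqP ->.
have clT : {in S & T, forall f x, f.[x] \in T}.
  move=> g x gS; rewrite !inE => /asboolP[s [f [s0 sS fS ->]]].
  apply/asboolP; exists (g :: s), f; split=> //; last by rewrite /= horner_comp.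
  by move=> h; rewrite inE => /predU1P[->|/sS].
have nsT : {in T, forall x s, x != s ^+ 2}.
  move=> x + r; rewrite inE => /asboolP[s [f [s0 sS fS ->]]].
  have wS : {subset rcons s f <= S}.
    by move=> g; rewrite mem_rcons inE => /predU1P[->|/sS].
  have wq : {in rcons s f, forall g, monic_quadratic g} by move=> g /wS/qS.
  rewrite -horner_comp -compose_all_rcons.
  apply: symmetric_irreducible_nonsquare => //.
  - exact: monic_compose_all.
  - by apply: irrS wS; case: (s).
  - rewrite size_compose_all // size_rcons; case: (s) s0 => // g s' _ /=.
    by rewrite !expnS mulnA dvdn_mulr.
  - rewrite compose_all_rcons -comp_polyA quadratic_symmetric //.
      exact: odd_card_two_neq0.
    exact: qS.
have T2 := card_disjoint_squares nsT.
have q0 : (0 < #|F|)%N := ltnW (finNzRing_gt1 F).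
have half_lt (t k : nat) : (0 < k -> 2 * t <= k -> t < k /\ k <= 2 * (k - t))%N.
  by lia.
have [tq qd] := half_lt _ _ q0 T2.
have bound := closed_family_bound uS qS T0 tq clT.
rewrite -(leq_pmul2r q0); apply: leq_trans (leq_mul (leqnn _) qd) _.
by rewrite mulnCA -mulnA leq_mul2l mulnn bound.
Qed.

Lemma ln_odd_lower (R : realType) (q : nat) : (3 <= q)%N ->
  2 / 3 <= ln (q%:R : R).
Proof.
move=> q3; have q3R : 3 <= q%:R :> R by rewrite ler_nat.
have q0 : 0 < q%:R :> R by lra.
have : ln (q%:R^-1 : R) <= q%:R^-1 - 1.
  rewrite -{1}(subrKC 1 (q%:R^-1)); apply: le_ln1Dx.
  by rewrite ltrBrDl subrr invr_gt0.
rewrite lnV ?posrE //.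
have : q%:R^-1 <= 3^-1 :> R by rewrite lef_pV2 ?posrE.
lra.
Qed.

Theorem corollary1 (R : realType) (F : finFieldType) (q : nat)
  (hF : #|F| = q) (hq : odd q) :
  (M F)%:R <= 32 * (ln (q%:R : R)) ^+ 4 * q%:R.
Proof.
have [S [uS qS irrS <-]] := M_attained F.
have q3 : (3 <= q)%N.
  by have := finNzRing_gt1 F; rewrite hF; case: q hq {hF} => [|[|[]]].
have : (size S)%:R <= 2 * q%:R :> R.
  rewrite -natrM ler_nat -hF.
  by apply: dynamically_irreducible_size => //; rewrite hF.
move/le_trans; apply; apply: ler_wpM2r => //.
have l23 := ln_odd_lower R q3.
apply: (@le_trans _ _ (32 * (2 / 3) ^+ 4)); first by lra.
apply: ler_wpM2l => //; apply: lerXn2r => //; rewrite nnegrE; lra.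
Qed.
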